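(* Let $X$ be a super-reflexive Banach space. There exist a constant $C_r>0$ and $w\in(0,1/2]$, depending only on $X$, such that the sequence $r_k(X)=C_r k^{-w}$ has the following property. For all natural numbers $n$ and $k$ with $1\le k\le n$: if $K_1,\ldots,K_n$ are convex sets in $X$ such that the unit ball $\mathbf{B}$ intersects $\bigcap_{j\in J}K_j$ for every $J\subset\{1,\dots,n\}$ with $|J|=k$, then there exists a point $x\in X$ such that \[ \operatorname{dist}(x,K_i)\le r_k(X)\quad\text{for all } i\in\{1,\dots,n\}. \]
   Context: Banach spaces are real. $\mathbf{B}=\{x\in X:\|x\|\le 1\}$ is the unit ball centered at the origin, and $\operatorname{dist}(a,S)=\inf_{s\in S}\|a-s\|$. A Banach space $X$ is super-reflexive if every Banach space finitely representable in $X$ is reflexive; equivalently, $X$ admits an equivalent uniformly convex norm. *)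

(* Defs.v *)
From HB Require Import structures.
From mathcomp Require Import all_boot all_order all_algebra.
From mathcomp Require Import all_classical all_reals all_analysis.

Set Implicit Arguments.
Unset Strict Implicit.
Unset Printing Implicit Defensive.

Import Order.TTheory GRing.Theory Num.Theory.
Import numFieldNormedType.Exports.

Local Open Scope classical_set_scope.
Local Open Scope ring_scope.

(* A Banach space over R is a [completeNormedModType R]. *)

Definition linear_span (R : realType) (V : lmodType R) (m : nat)
    (e : 'I_m -> V) : set V :=
  range (fun a : 'I_m -> R => \sum_(i < m) a i *: e i).

(* Only the restriction of T to F matters; F is meant to be a subspace. *)
Definition linear_on (R : realType) (U V : lmodType R) (F : set U)
    (T : U -> V) : Prop :=
  forall (a : R) (u v : U), F u -> F v -> T (a *: u + v) = a *: T u + T v.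

(* The finite-dimensional subspaces of Y are the spans of finite families.
   On such a subspace F the two bounds say that T is an isomorphism onto its
   image with ||T|| ||T^-1|| <= 1 + eps, rescaled so that ||T^-1|| <= 1. *)
Definition finitely_representable (R : realType)
    (Y X : completeNormedModType R) : Prop :=
  forall (m : nat) (e : 'I_m -> Y) (eps : R), 0 < eps ->
    exists T : Y -> X, linear_on (linear_span e) T /\
      forall y, linear_span e y -> `|y| <= `|T y| <= (1 + eps) * `|y|.

Definition unit_ball (R : realType) (X : normedModType R) : set X :=
  [set x | `|x| <= 1].

Definition dual_space (R : realType) (X : normedModType R) : set (X -> R^o) :=
  [set f : X -> R^o | linear f /\ continuous f].

Definition dual_norm (R : realType) (X : normedModType R)
    (f : X -> R^o) : R :=
  sup [set `|f x| | x in @unit_ball R X].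

(* Phi is a bounded linear functional on the dual of X; values outside the
   dual are irrelevant. *)
Definition in_bidual (R : realType) (X : normedModType R)
    (Phi : (X -> R^o) -> R^o) : Prop :=
  linear_on (@dual_space R X) Phi /\
  exists C : R, forall f, dual_space f -> `|Phi f| <= C * dual_norm f.

(* The canonical embedding of X into its bidual is onto. *)
Definition reflexive_space (R : realType) (X : completeNormedModType R) : Prop :=
  forall Phi : (X -> R^o) -> R^o, in_bidual Phi ->
    exists x : X, forall f, dual_space f -> Phi f = f x.

Definition super_reflexive (R : realType) (X : completeNormedModType R) : Prop :=
  forall Y : completeNormedModType R,
    finitely_representable Y X -> reflexive_space Y.

(* Extended-real valued, so that the distance to the empty set is +oo. *)
Definition dist (R : realType) (X : normedModType R) (a : X) (S : set X)
    : \bar R :=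
  ereal_inf [set `|a - s|%:E | s in S].

(* Main.v *)
Require Import Defs.
From HB Require Import structures.
From mathcomp Require Import all_boot all_order all_algebra.
From mathcomp Require Import all_classical all_reals all_analysis.
From mathcomp Require Import lra ring.

Set Implicit Arguments.
Unset Strict Implicit.
Unset Printing Implicit Defensive.

Import Order.TTheory GRing.Theory Num.Theory.
Import numFieldNormedType.Exports.

Local Open Scope classical_set_scope.
Local Open Scope ring_scope.

(** Call a finite index set T and a constant B < 1 good for X when every
    function y on the cube {-1, 1}^T with values in X has small
    first-order Fourier coefficients:
      sum over t of |E (e_t y(e))|^2 <= B |T| E |y(e)|^2
    (lemma names: [sign_coef], [sign_ineq]).  With B = 1 this always holds;
    for a Hilbert space B = 1 / |T| works.  The proof rests on four facts.

    - A super-reflexive space has a good pair (T, B) with |T| > 1 and B < 1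
      ([sign_ineq_or_ell1n]).  If B cannot be taken below 1 for
      T = {-1, 1}^m, then some nearly extremal y has all its values of norm
      at most about 1 and, for each t, the vectors e_t y(e) average to a vector of
      norm about 1.  An average of boundedly many vectors of norm at most 1
      can only be this long if all their convex combinations are long, and
      suitable points e yield m values of y that span a nearly isometric copy
      of l1^m.  If this happens for every m, then l1 is finitely
      representable in X ([ell1_finitely_representable]); but l1 is not
      reflexive ([ell1_not_reflexive]).

    - The inequality is multiplicative: (T, B) and (S, C) give
      (T * S, B * C) ([sign_ineq_prod]).  Hence index sets of size |T|^m
      come with the constant B^m, a negative power of their size; this is
      where the exponent w comes from.

    - The inequality yields an averaged form of the theorem
      ([helly_average]).  Given probabilities p on the sets K_i, draw a random
      family I of indices, independently with law p, and choose y(I) in the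
      unit ball and in all K_(I t).  Take for x the mean of y, and for z_i the
      mean of y conditioned on I t = i, averaged over t; convexity puts z_i
      in K_i.  Replacing each I t by an independent copy according to a sign
      e_t turns z_i - x into a first-order coefficient of a function on the
      cube, so the p-average of |z_i - x| is at most 2 sqrt B.

    - A minimax argument replaces the p-average, p arbitrary, by the maximum
      over i, up to an arbitrarily small error ([approx_minimax]). *)

(** * The Banach space l1 *)

Section Ell1.
Variable R : realType.
Implicit Types (x y : nat -> R).

Definition summable : {pred nat -> R} :=
  fun x => `[< exists M, forall n, \sum_(i < n) `|x i| <= M >].

Lemma summable_submod_closed : submod_closed summable.
Proof.
split.
  apply/asboolP; exists 0 => n; rewrite big1// => i _.
  by rewrite normr0.
move=> a x y /asboolP[M xM] /asboolP[N yN]; apply/asboolP.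
exists (`|a| * M + N) => n.
apply: (@le_trans _ _ (\sum_(i < n) (`|a| * `|x i| + `|y i|))).
  by apply: ler_sum => i _; rewrite -normrM; exact: ler_normD.
rewrite big_split -mulr_sumr /=; apply: lerD (yN n).
by apply: ler_wpM2l; [exact: normr_ge0|exact: xM].
Qed.

HB.instance Definition _ := GRing.isSubmodClosed.Build R (nat -> R) summable
  summable_submod_closed.

Record ell1 := Ell1 { ell1_val :> nat -> R; _ : ell1_val \in summable }.

HB.instance Definition _ := [isSub for ell1_val].
HB.instance Definition _ := [Choice of ell1 by <:].
HB.instance Definition _ := [SubChoice_isSubLmodule of ell1 by <:].

Implicit Types (u v : ell1).

(** The supremum of the partial sums makes every bound on the norm a statement
    about finite sums. *)
Definition ell1_norm u : R := sup (range (fun n => \sum_(i < n) `|u i|)).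

Lemma ell1_has_sup u : has_sup (range (fun n => \sum_(i < n) `|u i|)).
Proof.
case: u => x /= /asboolP[M xM]; split; first by exists (\sum_(i < 0) `|x i|), 0%N.
by exists M; move=> _ [n _ <-]; exact: xM.
Qed.

Lemma ell1_norm_ge u n : \sum_(i < n) `|u i| <= ell1_norm u.
Proof. by apply: sup_ubound; [exact: (ell1_has_sup u).2|exists n]. Qed.

Lemma ell1_norm_le u M :
  (forall n, \sum_(i < n) `|u i| <= M) -> ell1_norm u <= M.
Proof.
by move=> uM; apply: ge_sup; [exact: (ell1_has_sup u).1|move=> _ [n _ <-]].
Qed.

Lemma ell1_coord_le u n : `|u n| <= ell1_norm u.
Proof.
apply: le_trans (ell1_norm_ge u n.+1).
by rewrite big_ord_recr /= lerDr sumr_ge0.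
Qed.

Lemma ell1_valD u v n : (u + v) n = u n + v n.
Proof. by []. Qed.

Lemma ell1_valB u v n : (u - v) n = u n - v n.
Proof. by []. Qed.

Lemma ell1_valZ (a : R) u n : (a *: u) n = a * u n.
Proof. by []. Qed.

Lemma ell1_ler_normD u v : ell1_norm (u + v) <= ell1_norm u + ell1_norm v.
Proof.
apply: ell1_norm_le => n.
apply: le_trans (lerD (ell1_norm_ge u n) (ell1_norm_ge v n)).
by rewrite -big_split ler_sum// => i _; exact: ler_normD.
Qed.

Lemma ell1_normrZ (a : R) u : ell1_norm (a *: u) = `|a| * ell1_norm u.
Proof.
have le b w : ell1_norm (b *: w) <= `|b| * ell1_norm w.
  apply: ell1_norm_le => n.
  under eq_bigr do rewrite ell1_valZ normrM.
  by rewrite -mulr_sumr ler_wpM2l// ell1_norm_ge.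
apply/eqP; rewrite eq_le le /=.
have [->|a0] := eqVneq a 0.
  by rewrite normr0 mul0r; exact: le_trans (ell1_coord_le _ 0).
rewrite -ler_pdivlMl ?normr_gt0//.
by rewrite -normfV -[in leLHS](scalerK a0 u).
Qed.

Lemma ell1_normr0_eq0 u : ell1_norm u = 0 -> u = 0.
Proof.
move=> u0; apply/val_inj/funext => n; apply/eqP.
by rewrite -[_ == _]normr_le0 -u0 ell1_coord_le.
Qed.

HB.instance Definition _ := Lmodule_isNormed.Build R ell1
  ell1_ler_normD ell1_normrZ ell1_normr0_eq0.

(** A Cauchy filter converges at each coordinate, and a bound on the partial
    sums of differences passes to the coordinatewise limit, so that the limit
    is summable and is a limit in norm. *)
Lemma ell1_complete (F : set_system ell1) :
  ProperFilter F -> cauchy F -> cvg F.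
Proof.
move=> FF /cauchyP Fc.
have Fsmall e : 0 < e -> exists2 A, F A & forall u v, A u -> A v -> `|u - v| <= e.
  move=> e0; have [w Fw] := Fc (e / 2) (divr_gt0 e0 (ltr0Sn _ 1)).
  exists (ball w (e / 2)) => // u v wu wv.
  by apply: ltW; have := ball_splitr wu wv; rewrite -ball_normE.
have coord n : cvg ((fun u : ell1 => u n) @ F).
  apply/cauchy_cvgP/cauchyP => e e0; have [w Fw] := Fc e e0.
  exists (w n); rewrite /fmap /=; apply: filterS Fw => u /=.
  rewrite -!ball_normE /= => /(le_lt_trans _); apply.
  exact: (ell1_coord_le (w - u)).
pose l n := lim ((fun u : ell1 => u n) @ F).
have lP A e : F A -> (forall u v, A u -> A v -> `|u - v| <= e) ->
    forall u n, A u -> \sum_(i < n) `|u i - l i| <= e.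
  move=> FA Ae u n Au.
  have cv : \sum_(i < n) `|u i - (v : ell1) i| @[v --> F] --> \sum_(i < n) `|u i - l i|.
    apply: cvg_big => [|i _]; first exact: add_continuous.
    apply: cvg_norm; apply: cvgB; first exact: cvg_cst.
    exact: coord.
  apply: (cvgr_to_le cv); apply: filterS FA => v Av.
  exact: le_trans (ell1_norm_ge (u - v) n) (Ae _ _ Au Av).
have [A FA Ae] := Fsmall 1 ltr01.
have [w Aw] := filter_ex FA.
have ls : l \in summable.
  rewrite (_ : l = (w : nat -> R) - ((w : nat -> R) - l)); last by rewrite subKr.
  apply: rpredB; first exact: (valP w).
  by apply/asboolP; exists 1 => n; exact: (lP A 1 FA Ae w n Aw).
apply/cvg_ex; exists (Ell1 ls); apply/cvgrPdist_le => e e0.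
have [B FB Be] := Fsmall e e0.
apply: filterS (FB) => u Bu; rewrite distrC.
by apply: ell1_norm_le => n; exact: (lP B e FB Be u n Bu).
Qed.

HB.instance Definition _ := Uniform_isComplete.Build ell1 ell1_complete.

End Ell1.

(** * l1 is not reflexive *)

Section BoundedFunctionals.
Variables (R : realType) (X : normedModType R).

Lemma dual_space_bounded (f : X -> R^o) : dual_space f ->
  exists C, forall u, `|f u| <= C * `|u|.
Proof.
move=> [lf cf].
pose F : {linear X -> R^o} := HB.pack f (GRing.isLinear.Build _ _ _ _ f lf).
have /linear_boundedP : bounded_near F (nbhs 0) by exact/linear_bounded_continuous.
by move=> /pinfty_ex_gt0 [C _ FC]; exists C.
Qed.

Lemma bounded_dual_space (f : X -> R^o) C : linear f ->
  (forall u, `|f u| <= C * `|u|) -> dual_space f.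
Proof.
move=> lf fC; split=> //.
pose F : {linear X -> R^o} := HB.pack f (GRing.isLinear.Build _ _ _ _ f lf).
apply: (@bounded_linear_continuous _ _ _ F); apply/bounded_funP => r.
exists (`|C| * r) => u ur; apply: (le_trans (fC u)).
apply: (@le_trans _ _ (`|C| * `|u|)); first by rewrite ler_wpM2r// ler_norm.
by rewrite ler_wpM2l.
Qed.

Lemma le_dual_norm (f : X -> R^o) u : dual_space f -> `|u| <= 1 ->
  `|f u| <= dual_norm f.
Proof.
move=> /dual_space_bounded[C fC] u1; apply: sup_ubound; last by exists u.
exists (`|C|); move=> _ [v v1 <-]; apply: (le_trans (fC v)).
apply: (@le_trans _ _ (`|C| * `|v|)); first by rewrite ler_wpM2r// ler_norm.
by rewrite ler_piMr.
Qed.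

End BoundedFunctionals.

Section UltraLimit.
Variables (R : realType) (U : set_system nat).
Context {UU : UltraFilter U}.
Implicit Types a b : nat -> R.

(** Limits along a fixed ultrafilter give a linear choice of a limit for every
    bounded sequence. *)
Lemma bounded_ultra_cvg a (C : R) : (forall n, `|a n| <= C) -> cvg (a @ U).
Proof.
move=> aC.
have aI : \forall n \near U, `[- C, C]%classic (a n).
  by apply: filterE => n; have := aC n; rewrite ler_norml => h; rewrite /= in_itv /= h.
have [p [_ clp]] := @segment_compact R (- C) C (a @ U) _ aI.
apply/cvg_ex; exists p; apply/cvgrPdist_lt => e e0.
have [//|aNp] := in_ultra_setVsetC [set n | `|p - a n| < e] UU.
have UNp : \forall n \near U, (~` ball p e) (a n).
  by apply: filterS aNp => n /=; rewrite -ball_normE.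
by have [x [/= Nx /Nx]] := clp _ _ UNp (nbhsx_ballx p e e0).
Qed.

End UltraLimit.

Section Ell1NotReflexive.
Variable R : realType.
Local Notation ell1 := (ell1 R).

Lemma sum_delta (k N : nat) :
  \sum_(i < N) ((i : nat) == k)%:R = (k < N)%:R :> R.
Proof.
elim: N => [|N IH]; first by rewrite big_ord0.
rewrite big_ord_recr /= IH ltnS.
by case: ltngtP => _; rewrite /= ?mulr0n ?addr0 ?add0r.
Qed.

Lemma delta_summable k : (fun i => (i == k)%:R : R) \in @summable R.
Proof.
apply/asboolP; exists 1 => n.
under eq_bigr do rewrite ger0_norm//.
by rewrite sum_delta; case: ltnP.
Qed.

Definition ell1_delta k : ell1 := Ell1 (delta_summable k).

Lemma ell1_delta_norm k : `|ell1_delta k| <= 1.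
Proof.
apply: ell1_norm_le => n /=.
under eq_bigr do rewrite ger0_norm//.
by rewrite sum_delta; case: ltnP.
Qed.

(** Let Phi map f to the limit of f(delta_n) along an ultrafilter that contains
    all cofinite sets.  If Phi were the evaluation at some x, the coordinate
    functionals would force x = 0, while Phi is 1 on the functional that sums
    the coordinates. *)
Lemma ell1_not_reflexive : ~ reflexive_space ell1.
Proof.
have [U [UU sU]] := ultraFilterLemma (eventually_filter : ProperFilter \oo).
have FU : ProperFilter U := ultra_proper.
have cU (a : nat -> R) c : (\forall n \near \oo, a n = c) -> lim (a @ U) = c.
  by move=> ac; apply: cvg_lim => //; apply: cvg_near_cst; exact: sU.
pose Phi (f : ell1 -> R^o) : R^o := lim ((fun n => f (ell1_delta n) : R) @ U).
have dcvg f : dual_space f -> cvg ((fun n => f (ell1_delta n) : R) @ U).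
  move=> df; apply: (bounded_ultra_cvg (C := dual_norm f)) => n.
  exact: le_dual_norm (ell1_delta_norm n).
have scvg (u : ell1) : cvg ((fun n => \sum_(i < n) u i) @ U).
  apply: (bounded_ultra_cvg (C := `|u|)) => n.
  exact: le_trans (ler_norm_sum _ _ _) (ell1_norm_ge u n).
move=> refl; have [|x Phix] := refl Phi.
  split.
    move=> a f g df dg; apply: cvg_lim => //.
    by apply: cvgD; [apply: cvgZr; exact: dcvg|exact: dcvg].
  exists 1 => f df; rewrite mul1r.
  have cv : (`|f (ell1_delta n)| : R) @[n --> U] --> (`|Phi f| : R).
    exact: cvg_norm (dcvg f df).
  apply: (cvgr_to_le cv); apply: filterE => n.
  exact: le_dual_norm (ell1_delta_norm n).
have x0 n : x n = 0.
  have df : dual_space (fun u : ell1 => u n : R^o).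
    apply: (@bounded_dual_space _ _ _ 1) => // u.
    by rewrite mul1r ell1_coord_le.
  rewrite -(Phix _ df); apply: cU; near=> m => /=.
  by rewrite ltn_eqF//; near: m; exists n.+1.
(* The sum of a summable sequence is obtained as an ultrafilter limit too. *)
pose S (u : ell1) : R^o := lim ((fun n => \sum_(i < n) u i) @ U).
have dS : dual_space S.
  apply: (@bounded_dual_space _ _ _ 1) => [a u v|u].
    apply: cvg_lim => //.
    rewrite (_ : (fun n => _) =
      (fun n => a *: \sum_(i < n) u i + \sum_(i < n) v i)); last first.
      by apply/funext => n; rewrite scaler_sumr -big_split.
    by apply: cvgD; [apply: cvgZr; exact: scvg|exact: scvg].
  rewrite mul1r; have cv : `|\sum_(i < n) u i| @[n --> U] --> (`|S u| : R).
    exact: cvg_norm (scvg u).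
  apply: (cvgr_to_le cv); apply: filterE => n.
  exact: le_trans (ler_norm_sum _ _ _) (ell1_norm_ge u n).
have Sx : S x = 0.
  by apply: cU; near=> n; rewrite big1// => i _; exact: x0.
suff : Phi S = 1 by rewrite (Phix _ dS) Sx => /eqP; rewrite eq_sym oner_eq0.
apply: (cU); near=> k; apply: (cU); near=> n; rewrite /= sum_delta.
by rewrite (_ : (k < n)%N)//; near: n; exists k.+1.
Unshelve. all: by end_near. Qed.

End Ell1NotReflexive.

(** * Finite representability of l1 *)

Section Ell1Truncation.
Variable R : realType.
Local Notation ell1 := (ell1 R).
Implicit Types (u y : ell1).

Lemma ell1_val_sum (m : nat) (a : 'I_m -> R) (e : 'I_m -> ell1) n :
  (\sum_(i < m) a i *: e i) n = \sum_(i < m) a i * e i n.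
Proof. by apply: (big_morph (fun u : ell1 => u n)). Qed.

Lemma ell1_tail_small u (eta : R) : 0 < eta -> exists N0, forall N M,
  (N0 <= N)%N -> \sum_(N <= i < M) `|u i| <= eta.
Proof.
move=> eta0; have [_ [N0 _ <-] uN0] := sup_adherent eta0 (ell1_has_sup u).
exists N0 => N M N0N.
have [MN|NM] := leqP M N; first by rewrite big_geq// ltW.
have := ell1_norm_ge u M; move: uN0; rewrite -/(ell1_norm u).
rewrite -!(big_mkord xpredT (fun i => `|u i|)).
rewrite (big_cat_nat (n := N0) (m := 0) (p := M)) ?(leq_trans N0N (ltnW NM))//=.
rewrite (big_cat_nat (n := N) (m := N0) (p := M)) ?(ltnW NM)//=.
have : 0 <= \sum_(N0 <= i < N) `|u i| by exact: sumr_ge0.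
lra.
Qed.

(** One step of Gaussian elimination: subtracting multiples of the first vector
    makes the other ones vanish at a coordinate n where it does not, so that
    the coefficient of the first vector in y is read off from y n and is
    controlled by the norm of y. *)
Lemma ell1_span_pivot (m : nat) (e : 'I_m.+1 -> ell1) :
  exists (e' : 'I_m -> ell1) (k : R), 0 <= k /\
  forall y, linear_span e y -> exists b u,
    [/\ linear_span e' u, y = b *: e ord0 + u & `|b| <= k * `|y|].
Proof.
have [e0|e0] := eqVneq (e ord0) 0.
  exists (fun i => e (lift ord0 i)), 0; split=> // _ [a _ <-].
  exists 0, (\sum_(i < m) a (lift ord0 i) *: e (lift ord0 i)); split.
  - by exists (fun i => a (lift ord0 i)).
  - by rewrite big_ord_recl e0 !scaler0.
  - by rewrite normr0 mul0r.
have [n en] : exists n, e ord0 n != 0.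
  apply: contrapT => /forallNP en; move/eqP: e0; apply.
  by apply/val_inj/funext => n; apply/eqP/negPn/negP; exact: en.
exists (fun i => e (lift ord0 i) - (e (lift ord0 i) n / e ord0 n) *: e ord0).
exists `|e ord0 n|^-1; split; first by rewrite invr_ge0.
move=> _ [a _ <-]; set y := \sum_(i < m.+1) _.
pose u := \sum_(i < m) a (lift ord0 i) *:
  (e (lift ord0 i) - (e (lift ord0 i) n / e ord0 n) *: e ord0).
pose b := a ord0 + \sum_(i < m) a (lift ord0 i) * (e (lift ord0 i) n / e ord0 n).
have yE : y = b *: e ord0 + u.
  rewrite /y /u big_ord_recl scalerDl -addrA scaler_suml -big_split /=.
  congr (_ + _); apply: eq_bigr => i _.
  by rewrite scalerBr scalerA addrC subrK.
have un : u n = 0.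
  rewrite ell1_val_sum big1// => i _; rewrite ell1_valB ell1_valZ.
  by rewrite divfK// subrr mulr0.
exists b, u; split=> //; first by exists (fun i => a (lift ord0 i)).
rewrite ler_pdivlMl ?normr_gt0// -normrM; apply: le_trans (ell1_coord_le y n).
by rewrite yE ell1_valD un addr0 ell1_valZ mulrC.
Qed.

(** Truncation is almost isometric on a finite-dimensional subspace.  Peeling off
    the spanning vectors by elimination reduces this to the smallness of the
    tails of finitely many vectors. *)
Lemma ell1_span_tail_small (m : nat) (e : 'I_m -> ell1) (eta : R) : 0 < eta ->
  exists N0, forall N M y, (N0 <= N)%N -> linear_span e y ->
    \sum_(N <= i < M) `|y i| <= eta * `|y|.
Proof.
elim: m e eta => [|m IH] e eta eta0.
  exists 0%N => N M _ _ [a _ <-]; rewrite big_ord0.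
  rewrite big1 ?normr0 ?mulr0// => i _; exact: normr0.
have [e' [k [k0 ek]]] := ell1_span_pivot e.
pose eta1 := eta / 2 / (k + 1); pose eta2 := eta / 2 / (1 + k * `|e ord0|).
have k1 : 0 < k + 1 by rewrite ltr_wpDl.
have k2 : 0 < 1 + k * `|e ord0| by rewrite ltr_wpDr// mulr_ge0.
have [N1 eN1] : exists N0, forall N M, (N0 <= N)%N ->
    \sum_(N <= i < M) `|e ord0 i| <= eta1.
  by apply: ell1_tail_small; rewrite !divr_gt0.
have [N2 eN2] : exists N0, forall N M y, (N0 <= N)%N -> linear_span e' y ->
    \sum_(N <= i < M) `|y i| <= eta2 * `|y|.
  by apply: IH; rewrite !divr_gt0.
exists (maxn N1 N2) => N M y; rewrite geq_max => /andP[N1N N2N].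
move=> /ek[b [u [eu yE bk]]].
have uy : `|u| <= (1 + k * `|e ord0|) * `|y|.
  rewrite (_ : u = y - b *: e ord0); last by rewrite yE addrC addKr.
  apply: (le_trans (ler_normB _ _)); rewrite mulrDl mul1r lerD2l normrZ mulrAC.
  by rewrite ler_wpM2r.
have -> : eta * `|y| = `|y| * (k + 1) * eta1 + eta2 * ((1 + k * `|e ord0|) * `|y|).
  by rewrite /eta1 /eta2; field; rewrite !gt_eqF.
apply: (@le_trans _ _ (\sum_(N <= i < M) (`|b| * `|e ord0 i| + `|u i|))).
  by apply: ler_sum => i _; rewrite yE -normrM; exact: ler_normD.
rewrite big_split /= -mulr_sumr; apply: lerD.
  apply: ler_pM; rewrite ?sumr_ge0 ?eN1//.
  by apply: (le_trans bk); rewrite mulrC ler_wpM2l// lerDl.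
apply: (le_trans (eN2 _ _ _ N2N eu)); apply: ler_wpM2l uy.
by rewrite ltW// !divr_gt0.
Qed.

End Ell1Truncation.

Definition contains_ell1n (R : realType) (X : normedModType R) : Prop :=
  forall (N : nat) (eta : R), 0 < eta -> exists x : 'I_N -> X,
    forall c : 'I_N -> R, \sum_(i < N) `|c i| <= `|\sum_(i < N) c i *: x i|
      <= (1 + eta) * \sum_(i < N) `|c i|.

(** A finite-dimensional subspace of l1 is truncated to N coordinates and then
    mapped into the copy of l1^N in X; each of the two maps costs a factor
    1 + eta. *)
Lemma ell1_finitely_representable (R : realType) (X : completeNormedModType R) :
  contains_ell1n X -> finitely_representable (ell1 R) X.
Proof.
move=> X1 m e eps eps0; pose eta := Num.min 1 (eps / 3).
have eta0 : 0 < eta by rewrite lt_min ltr01 divr_gt0.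
have eta1 : eta <= 1 by rewrite ge_min lexx.
have eta3 : eta <= eps / 3 by rewrite ge_min lexx orbT.
have [N eN] := ell1_span_tail_small e (divr_gt0 eta0 (addr_gt0 ltr01 eta0)).
have [x xN] := X1 N eta eta0.
have trunc (y : ell1 R) : linear_span e y ->
    `|y| <= (1 + eta) * \sum_(i < N) `|y i|.
  move=> ey; have y_le : `|y| <= \sum_(i < N) `|y i| + eta / (1 + eta) * `|y|.
    apply: ell1_norm_le => n; apply: (@le_trans _ _ (\sum_(i < maxn N n) `|y i|)).
      rewrite -!(big_mkord xpredT (fun i => `|y i|)).
      rewrite (big_cat_nat (n := n) (p := maxn N n)) ?leq_maxr//=.
      by rewrite lerDl sumr_ge0.
    rewrite -!(big_mkord xpredT (fun i => `|y i|)).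
    rewrite (big_cat_nat (n := N) (p := maxn N n)) ?leq_maxl//=.
    by rewrite lerD2l eN.
  have E : `|y| = (1 + eta) * (`|y| - eta / (1 + eta) * `|y|).
    by field; rewrite gt_eqF// addr_gt0.
  by rewrite E ler_pM2l ?addr_gt0// lerBlDr.
exists (fun y : ell1 R => (1 + eta) *: \sum_(i < N) y i *: x i); split.
  move=> a u v _ _; rewrite /= scalerA (mulrC a) -scalerA -scalerDr.
  congr (_ *: _); rewrite scaler_sumr -big_split /=.
  by apply: eq_bigr => i _; rewrite scalerA -scalerDl.
move=> y ey; have /andP[lo hi] := xN (fun i => y i).
rewrite normrZ gtr0_norm ?addr_gt0//; apply/andP; split.
  by apply: (le_trans (trunc y ey)); rewrite ler_pM2l ?addr_gt0.
apply: (@le_trans _ _ ((1 + eta) * ((1 + eta) * `|y|))).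
  rewrite ler_pM2l ?addr_gt0//; apply: (le_trans hi).
  by rewrite ler_pM2l ?addr_gt0//; exact: ell1_norm_ge.
rewrite mulrA ler_wpM2r//; nra.
Qed.

Lemma super_reflexive_not_ell1n (R : realType) (X : completeNormedModType R) :
  super_reflexive X -> ~ contains_ell1n X.
Proof.
by move=> sX /ell1_finitely_representable /sX; exact: ell1_not_reflexive.
Qed.

(** * Averages and first-order coefficients on the cube *)

Section Mean.
Variables (R : realType) (I : finType).

Definition mean (V : lmodType R) (f : I -> V) : V :=
  #|I|%:R^-1 *: \sum_i f i.

Lemma eq_mean (V : lmodType R) (f g : I -> V) : f =1 g -> mean f = mean g.
Proof. by move=> fg; congr (_ *: _); apply: eq_bigr. Qed.

Lemma mean_reindex (V : lmodType R) (h : I -> I) (f : I -> V) :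
  injective h -> mean (fun i => f (h i)) = mean f.
Proof. by move=> hI; congr (_ *: _); rewrite [RHS](reindex_inj hI). Qed.

Lemma meanZ (V : lmodType R) (a : R) (f : I -> V) :
  mean (fun i => a *: f i) = a *: mean f.
Proof. by rewrite /mean -scaler_sumr !scalerA mulrC. Qed.

Lemma meanD (V : lmodType R) (f g : I -> V) :
  mean (fun i => f i + g i) = mean f + mean g.
Proof. by rewrite /mean big_split scalerDr. Qed.

Lemma mean_sum (V : lmodType R) (J : finType) (f : J -> I -> V) :
  mean (fun i => \sum_j f j i) = \sum_j mean (f j).
Proof. by rewrite /mean exchange_big -scaler_sumr. Qed.

Lemma le_mean (f g : I -> R^o) : (forall i, f i <= g i) -> mean f <= mean g.
Proof.
by move=> fg; apply: ler_wpM2l; [rewrite invr_ge0|apply: ler_sum].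
Qed.

Lemma norm_mean_le (V : normedModType R) (f : I -> V) :
  `|mean f| <= mean (fun i => `|f i| : R^o).
Proof.
rewrite normrZ ger0_norm ?invr_ge0//; apply: ler_wpM2l; first by rewrite invr_ge0.
exact: ler_norm_sum.
Qed.

Hypothesis I0 : (0 < #|I|)%N.

Let nI0 : #|I|%:R != 0 :> R.
Proof. by rewrite pnatr_eq0 -lt0n. Qed.

Lemma mean_const (V : lmodType R) (v : V) : mean (fun=> v) = v.
Proof. by rewrite /mean sumr_const -[v *+ _]scaler_nat scalerA mulVf// scale1r. Qed.

Lemma card_mean (V : lmodType R) (f : I -> V) : #|I|%:R *: mean f = \sum_i f i.
Proof. by rewrite /mean scalerA divff// scale1r. Qed.

Lemma card_meanR (f : I -> R^o) : #|I|%:R * mean f = \sum_i f i.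
Proof. exact: card_mean. Qed.

Lemma mean_sqr_ge (f : I -> R^o) : mean f ^+ 2 <= mean (fun i => f i ^+ 2 : R^o).
Proof.
rewrite -subr_ge0; set m := mean f.
have -> : mean (fun i => f i ^+ 2 : R^o) - m ^+ 2 =
    mean (fun i => (f i - m) ^+ 2 : R^o).
  have -> : mean (fun i => (f i - m) ^+ 2 : R^o) =
      mean (fun i => (f i ^+ 2 : R^o) + (((- (2 * m)) *: f i) + (m ^+ 2 : R^o))).
    by apply: eq_mean => i; rewrite -[_ *: _]/(- (2 * m) * f i); ring.
  rewrite meanD (meanD (fun i => - (2 * m) *: f i)) meanZ mean_const.
  by rewrite -/m -[_ *: m]/(- (2 * m) * m); ring.
by rewrite -(mean_const (0 : R^o)); apply: le_mean => i; exact: sqr_ge0.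
Qed.

Lemma sqr_norm_mean_le (V : normedModType R) (f : I -> V) :
  `|mean f| ^+ 2 <= mean (fun i => `|f i| ^+ 2 : R^o).
Proof.
apply: le_trans (mean_sqr_ge (fun i => `|f i|)).
by rewrite lerXn2r ?nnegrE// ?norm_mean_le// (le_trans _ (norm_mean_le f)).
Qed.

End Mean.

Lemma exchange_mean (R : realType) (I J : finType) (V : lmodType R)
    (f : I -> J -> V) :
  mean (fun i => mean (f i)) = mean (fun j => mean (f^~ j)).
Proof.
rewrite /mean -[in LHS]scaler_sumr -[in RHS]scaler_sumr !scalerA mulrC.
by rewrite exchange_big.
Qed.

Notation cube T := {ffun T -> bool}.

Lemma card_cube_gt0 (T : finType) : (0 < #|cube T|)%N.
Proof. by apply/card_gt0P; exists [ffun=> false]. Qed.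

(** Multiplication of sign vectors, with [true] standing for the sign -1. *)
Definition flip (T : finType) (d e : cube T) : cube T :=
  [ffun t => d t (+) e t].

Lemma flip_inj (T : finType) (d : cube T) : injective (flip d).
Proof.
by apply: inv_inj => e; apply/ffunP => t; rewrite !ffunE addbA addbb.
Qed.

Section SignInequality.
Variables (R : realType) (X : normedModType R).

Definition sign_coef (T : finType) (y : cube T -> X) (t : T) : X :=
  mean (fun e : cube T => (-1) ^+ (e t) *: y e).

(** The dual form of a type 2 estimate for |T| vectors.  It always holds for
    B = 1.  A constant B < 1 excludes nearly isometric copies of l1^n in X for
    n = 2 ^ |T|: if y runs through the unit vectors of such a copy, all its
    coefficients have norm about 1. *)
Definition sign_ineq (T : finType) (B : R) : Prop :=
  forall y : cube T -> X, \sum_t `|sign_coef y t| ^+ 2 <=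
    B * #|T|%:R * mean (fun e => `|y e| ^+ 2 : R^o).

(** The coefficient of y at t does not change when y is replaced by its partial
    coefficient along directions d_j: substituting flip (d j) e for e in the
    j-th term multiplies the sign of e at t by that of d_j. *)
Lemma sign_coef_flip_mean (T J : finType) (d : J -> cube T) (t : T)
    (y : cube T -> X) : (0 < #|J|)%N ->
  sign_coef y t =
  sign_coef (fun e => mean (fun j => (-1) ^+ (d j t) *: y (flip (d j) e))) t.
Proof.
move=> J0; rewrite /sign_coef.
under [RHS]eq_mean do rewrite -meanZ.
rewrite exchange_mean /= -[LHS](mean_const J0); apply: eq_mean => j.
rewrite -(mean_reindex _ (flip_inj (d := d j))); apply: eq_mean => e.
by rewrite scalerA -signr_addb !ffunE addbC.
Qed.

Lemma mean_flip_mean (T J : finType) (d : J -> cube T) (f : cube T -> R^o) :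
  (0 < #|J|)%N -> mean (fun e => mean (fun j => f (flip (d j) e))) = mean f.
Proof.
move=> J0; rewrite exchange_mean -[RHS](mean_const J0); apply: eq_mean => j.
exact: mean_reindex (flip_inj (d := d j)).
Qed.

Lemma sqr_norm_sign_coef_le (T : finType) (y : cube T -> X) t :
  `|sign_coef y t| ^+ 2 <= mean (fun e => `|y e| ^+ 2 : R^o).
Proof.
apply: le_trans (sqr_norm_mean_le _ _) _; first exact: card_cube_gt0.
by apply: le_mean => e; rewrite normrZ normr_sign mul1r.
Qed.

(** Apply the inequality for T to the sign changes that are constant on each
    block {t} * S, and then, for each t, the inequality for S to the sign
    changes inside the block t.  Using second moments on both sides is what
    allows the two steps to be chained. *)
Lemma sign_ineq_prod (T S : finType) (B C : R) : 0 <= B -> 0 <= C ->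
  sign_ineq T B -> sign_ineq S C -> sign_ineq (T * S)%type (B * C).
Proof.
move=> B0 C0 QT QS y.
pose row (a : cube T) : cube (T * S)%type := [ffun p => a p.1].
pose blk t (s : cube S) : cube (T * S)%type := [ffun p => s p.2 && (p.1 == t)].
pose G t e := mean (fun a : cube T => (-1) ^+ (a t) *: y (flip (row a) e)).
have coefG t s : sign_coef y (t, s) = sign_coef (G t) (t, s).
  apply: etrans (sign_coef_flip_mean row _ _ (card_cube_gt0 T)) _.
  congr sign_coef; apply/funext => e; by apply: eq_mean => a; rewrite !ffunE.
have coefGG t s : sign_coef y (t, s) =
    sign_coef (fun e => sign_coef (fun a => G t (flip (blk t a) e)) s) (t, s).
  rewrite coefG.
  apply: etrans (sign_coef_flip_mean (blk t) _ _ (card_cube_gt0 S)) _.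
  congr sign_coef; apply/funext => e; apply: eq_mean => a.
  by rewrite !ffunE /= eqxx andbT.
have rowS t : \sum_s `|sign_coef y (t, s)| ^+ 2 <=
    C * #|S|%:R * mean (fun e => `|G t e| ^+ 2 : R^o).
  apply: (@le_trans _ _ (mean (fun e => \sum_s
      `|sign_coef (fun a => G t (flip (blk t a) e)) s| ^+ 2 : R^o))).
    rewrite mean_sum; apply: ler_sum => s _.
    by rewrite coefGG; exact: sqr_norm_sign_coef_le.
  rewrite -(mean_flip_mean (blk t) (fun e => `|G t e| ^+ 2 : R^o)); last first.
    exact: card_cube_gt0.
  by rewrite -[leRHS]meanZ; apply: le_mean => e; exact: QS.
have -> : \sum_p `|sign_coef y p| ^+ 2 =
    \sum_t \sum_s `|sign_coef y (t, s)| ^+ 2.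
  by rewrite pair_bigA; apply: eq_bigr => -[].
apply: (le_trans (ler_sum _ (fun t _ => rowS t))).
rewrite -mulr_sumr -mean_sum card_prod natrM.
have -> : B * C * (#|T|%:R * #|S|%:R) = C * #|S|%:R * (B * #|T|%:R) by ring.
rewrite -mulrA ler_wpM2l ?mulr_ge0//.
rewrite -(mean_flip_mean row (fun e => `|y e| ^+ 2 : R^o)) ?card_cube_gt0//.
by rewrite -[leRHS]meanZ; apply: le_mean => e; exact: QT.
Qed.

Lemma sign_ineq_unit : sign_ineq unit 1.
Proof.
move=> y; rewrite mul1r card_unit mul1r (bigD1 tt)//= big1 => [|[]//].
rewrite addr0; exact: sqr_norm_sign_coef_le.
Qed.

Lemma sign_ineq_exp (T : finType) (B : R) m : 0 <= B -> sign_ineq T B ->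
  exists S : finType, #|S| = (#|T| ^ m)%N /\ sign_ineq S (B ^+ m).
Proof.
move=> B0 QT; elim: m => [|m [S [cS QS]]].
  by exists unit; rewrite card_unit expr0; split=> //; exact: sign_ineq_unit.
exists (T * S)%type; rewrite card_prod cS expnS exprS; split=> //.
by apply: sign_ineq_prod => //; exact: exprn_ge0.
Qed.

End SignInequality.

(** * Failure of the sign inequality produces copies of l1 *)

Section FailureGivesEll1.
Variables (R : realType) (X : normedModType R).

(** Normalize E |y|^2 to 1.  Each squared coefficient is at most 1 and their sum
    is nearly |T|, so each of them is nearly 1.  Hence E |y| is nearly 1 as
    well, |y| has small variance, and no value of |y| exceeds 1 by much. *)
Lemma sign_ineq_near_extremal (T : finType) (theta : R) :
  0 < theta <= 1 ->
  ~ sign_ineq X T (1 - theta ^+ 2 / (2 * #|cube T|%:R * #|T|%:R)) ->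
  exists y : cube T -> X, (forall e, `|y e| <= 1 + theta) /\
    (forall t, 1 - theta <= `|sign_coef y t|).
Proof.
move=> /andP[th0 th1] /existsNP[y0 /negP]; rewrite -ltNge.
set N : R := #|cube T|%:R; set B := 1 - _; set A := mean _ => hy.
have N1 : 1 <= N by rewrite ler1n card_cube_gt0.
have A0 : 0 <= A by apply: le_trans (sqr_norm_mean_le (card_cube_gt0 T) y0).
have coefA t : `|sign_coef y0 t| ^+ 2 <= A by exact: sqr_norm_sign_coef_le.
have sumA : \sum_t `|sign_coef y0 t| ^+ 2 <= #|T|%:R * A.
  apply: (le_trans (ler_sum _ (fun t _ => coefA t))).
  by rewrite sumr_const mulr_natl.
have T0 : 0 < #|T|%:R :> R.
  rewrite ltr0n lt0n; apply/negP => /eqP T0; move: hy.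
  rewrite T0 mulr0 mul0r big1 ?ltxx// => t _.
  by have /card0_eq/(_ t) := T0; rewrite inE.
have Apos : 0 < A.
  rewrite lt_neqAle A0 andbT; apply/negP => /eqP A_0; move: hy.
  by rewrite -A_0 mulr0 ltNge; move: sumA; rewrite -A_0 mulr0 => ->.
pose a := (Num.sqrt A)^-1; have a0 : 0 < a by rewrite invr_gt0 sqrtr_gt0.
have aA : a ^+ 2 * A = 1 by rewrite /a exprVn sqr_sqrtr// mulVf// gt_eqF.
exists (fun e => a *: y0 e).
have coefE t : sign_coef (fun e => a *: y0 e) t = a *: sign_coef y0 t.
  by rewrite /sign_coef -meanZ; apply: eq_mean => e; rewrite !scalerA mulrC.
have coef_ge t : 1 - theta ^+ 2 / (2 * N) <= `|sign_coef (fun e => a *: y0 e) t|.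
  have c2 : 1 - theta ^+ 2 / (2 * N) <= `|sign_coef (fun e => a *: y0 e) t| ^+ 2.
    rewrite coefE normrZ (gtr0_norm a0) exprMn.
    have : B * #|T|%:R * A < `|sign_coef y0 t| ^+ 2 + (#|T|%:R - 1) * A.
      apply: (lt_le_trans hy); rewrite (bigD1 t)//= lerD2l.
      apply: (le_trans (ler_sum _ (fun s _ => coefA s))).
      rewrite sumr_const cardC1 mulrBl mul1r mulr_natl -subn1 mulrnBr ?mulr1n//.
      by rewrite -(ltr0n R).
    have -> : B * #|T|%:R * A = (#|T|%:R - theta ^+ 2 / (2 * N)) * A.
      by rewrite /B; field; rewrite !gt_eqF// (lt_le_trans ltr01).
    move=> /ltW /(ler_wpM2l (sqr_ge0 a)).
    have E z : a ^+ 2 * (z * A) = z by rewrite mulrCA aA mulr1.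
    rewrite mulrDr !E; lra.
  apply: (le_trans c2); rewrite expr2 ler_piMr//.
  rewrite -(@ler_pXn2r _ 2%N) ?nnegrE// expr1n coefE normrZ (gtr0_norm a0) exprMn.
  by rewrite -aA ler_wpM2l ?sqr_ge0.
have d_le : theta ^+ 2 / (2 * N) <= theta.
  by rewrite ler_pdivrMr ?mulr_gt0 ?(lt_le_trans ltr01)//; nra.
split=> [e|t]; last by apply: le_trans (coef_ge t); rewrite lerD2l lerN2.
pose u e := `|a *: y0 e|.
have mu2 : mean (fun e => u e ^+ 2 : R^o) = 1.
  rewrite -aA -[RHS](meanZ (V := R^o)); apply: eq_mean => f.
  by rewrite /u normrZ (gtr0_norm a0) exprMn.
have [t _] : exists t : T, True.
  by move: T0; rewrite ltr0n => /card_gt0P[t _]; exists t.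
have mu : 1 - theta ^+ 2 / (2 * N) <= mean (fun e => u e : R^o).
  apply: (le_trans (coef_ge t)); apply: (le_trans (norm_mean_le _)).
  by apply: le_mean => f; rewrite normrZ normr_sign mul1r.
have msq : mean (fun e => (u e - 1) ^+ 2 : R^o) <= theta ^+ 2 / N.
  have -> : mean (fun e => (u e - 1) ^+ 2 : R^o) =
      mean (fun e => (u e ^+ 2 : R^o) + (((- 2) *: (u e : R^o)) + (1 : R^o))).
    by apply: eq_mean => f; rewrite -[_ *: _]/(- 2 * u f); ring.
  rewrite meanD (meanD (fun f => (-2) *: (u f : R^o))) meanZ.
  rewrite mean_const ?card_cube_gt0// mu2 -[_ *: _]/(- 2 * mean _).
  have -> : theta ^+ 2 / N = 2 * (theta ^+ 2 / (2 * N)).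
    by field; rewrite gt_eqF// (lt_le_trans ltr01).
  lra.
have ue : (u e - 1) ^+ 2 <= theta ^+ 2.
  have N0 : 0 < N by exact: lt_le_trans N1.
  move: msq; rewrite ler_pdivlMr// mulrC card_meanR ?card_cube_gt0//.
  apply: le_trans; rewrite (bigD1 e)//= lerDl.
  by apply: sumr_ge0 => f _; exact: sqr_ge0.
rewrite -/(u e); nra.
Qed.

(** The sum of the v_i, scaled by s, is the combination with weights w_i plus
    one with weights s - w_i, whose norm is at most r times its total weight.
    So a mean of norm close to r leaves every combination long. *)
Lemma mean_convex_comb_ge (I : finType) (v : I -> X) (w : I -> R) (s r : R) :
  (forall i, `|v i| <= r) -> (forall i, 0 <= w i <= s) ->
  s * #|I|%:R * `|mean v| <= `|\sum_i w i *: v i| +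
     (s * #|I|%:R - \sum_i w i) * r.
Proof.
move=> vr ws.
have [I0|I0] := posnP #|I|.
  rewrite I0 mulr0 mul0r !big1 ?normr0 ?subrr ?mul0r ?addr0// => i _.
    by have /card0_eq/(_ i) := I0; rewrite inE.
  by have /card0_eq/(_ i) := I0; rewrite inE.
have [i0 _] : exists i0 : I, True by move/card_gt0P: I0 => [i]; exists i.
have s0 : 0 <= s by have /andP[] := ws i0; exact: le_trans.
have -> : s * #|I|%:R * `|mean v| = `|\sum_i s *: v i|.
  rewrite -scaler_sumr -(card_mean I0) !normrZ (ger0_norm s0).
  by rewrite (ger0_norm (ler0n _ _)) mulrA.
have -> : \sum_i s *: v i = \sum_i w i *: v i + \sum_i (s - w i) *: v i.
  by rewrite -big_split /=; apply: eq_bigr => i _; rewrite -scalerDl addrC subrK.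
apply: (le_trans (ler_normD _ _)); rewrite lerD2l.
apply: (le_trans (ler_norm_sum _ _ _)).
apply: (@le_trans _ _ (\sum_i (s - w i) * r)); last first.
  by rewrite -mulr_suml sumrB sumr_const mulr_natr.
apply: ler_sum => i _; have /andP[_ wi] := ws i.
by rewrite normrZ ger0_norm ?subr_ge0// ler_wpM2l// subr_ge0.
Qed.

(** Index the coordinates of the cube by the sign patterns t of length m, and let
    e_i be the point whose coordinate at t is the i-th entry of t.  For t the
    sign pattern of c, the vector sum of the c_i y(e_i) is a combination with
    weights |c_i| of the vectors e_t y(e), whose mean is long. *)
Lemma sign_coef_ge_ell1n (m : nat) (theta : R)
    (y : cube {ffun 'I_m -> bool} -> X) :
  (forall e, `|y e| <= 1 + theta) ->
  (forall t, 1 - theta <= `|sign_coef y t|) -> 0 <= theta ->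
  exists x : 'I_m -> X, forall c : 'I_m -> R,
    (1 - 2 * #|cube {ffun 'I_m -> bool}|%:R * theta) * \sum_i `|c i|
      <= `|\sum_i c i *: x i| <= (1 + theta) * \sum_i `|c i|.
Proof.
move=> y_le coef_ge theta0.
pose pt (i : 'I_m) : cube {ffun 'I_m -> bool} := [ffun t : {ffun 'I_m -> bool} => t i].
exists (fun i => y (pt i)) => c; apply/andP; split; last first.
  apply: (le_trans (ler_norm_sum _ _ _)); rewrite mulr_sumr.
  by apply: ler_sum => i _; rewrite normrZ mulrC ler_wpM2r.
set N : R := #|_|%:R; set S := \sum_i _.
pose t : {ffun 'I_m -> bool} := [ffun i => c i < 0].
pose v (e : cube {ffun 'I_m -> bool}) : X := (-1) ^+ (e t) *: y e.
pose w e := \sum_(i | pt i == e) `|c i|.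
have cE : \sum_i c i *: y (pt i) = \sum_e w e *: v e.
  rewrite (partition_big pt xpredT)//=; apply: eq_bigr => e _.
  rewrite scaler_suml; apply: eq_bigr => i /eqP <-.
  rewrite /v !ffunE scalerA; congr (_ *: _).
  by rewrite mulrC -realEsign// num_real.
have sum_w : \sum_e w e = S.
  by rewrite /S (partition_big pt xpredT).
have w_le e : 0 <= w e <= S.
  rewrite sumr_ge0//= /S [leRHS](bigID (fun i => pt i == e)) /= lerDl.
  by rewrite sumr_ge0.
have v_le e : `|v e| <= 1 + theta by rewrite normrZ normr_sign mul1r.
have := mean_convex_comb_ge v_le w_le; rewrite -cE sum_w -/N.
have S0 : 0 <= S by rewrite sumr_ge0.
have N0 : 0 <= S * N by rewrite mulr_ge0.
have := ler_wpM2l N0 (coef_ge t); rewrite -/(mean v) /sign_coef -/v; nra.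
Qed.

Lemma sign_ineq_or_ell1n : ~ contains_ell1n X ->
  exists (T : finType) (B : R), [/\ (1 < #|T|)%N, 0 < B < 1 & sign_ineq X T B].
Proof.
move=> X1; apply: contrapT => noQ; apply: X1 => m eta eta0.
have [->|m0] := posnP m.
  by exists (fun=> 0) => c; rewrite !big_ord0 normr0 mulr0 lexx.
pose T : finType := {ffun 'I_m -> bool}; pose N : R := #|cube T|%:R.
have T1 : (1 < #|T|)%N.
  rewrite card_ffun card_bool card_ord -[1%N]/(2 ^ 0)%N ltn_exp2l//.
have N1 : 1 <= N by rewrite ler1n card_cube_gt0.
(* Chosen so that (1 + eta) (1 - 2 N theta) = 1 + theta. *)
pose theta := eta / (1 + 2 * N * (1 + eta)).
have den0 : 0 < 1 + 2 * N * (1 + eta) by nra.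
have th0 : 0 < theta by rewrite divr_gt0.
have thE : theta * (1 + 2 * N * (1 + eta)) = eta by rewrite divfK// gt_eqF.
have th1 : theta <= 1 by rewrite ler_pdivrMr// mul1r; nra.
have lo0 : 0 < 1 - 2 * N * theta.
  have eta1 : 0 < 1 + eta by rewrite addr_gt0.
  have E : (1 - 2 * N * theta) * (1 + eta) = 1 + theta by move: thE; lra.
  by rewrite -(pmulr_lgt0 _ eta1) E addr_gt0.
have T0 : 1 <= #|T|%:R :> R by rewrite ler1n ltnW.
have [y [y_le coef_ge]] : exists y : cube T -> X,
    (forall e, `|y e| <= 1 + theta) /\ (forall t, 1 - theta <= `|sign_coef y t|).
  apply: sign_ineq_near_extremal => [|Q]; first by rewrite th0.
  apply: noQ; eexists; eexists; split; [exact: T1| |exact: Q].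
  have NT : 0 < 2 * N * #|T|%:R by nra.
  rewrite gtrBl divr_gt0 ?exprn_gt0// andbT subr_gt0 ltr_pdivrMr// mul1r.
  nra.
have [x xc] := sign_coef_ge_ell1n y_le coef_ge (ltW th0).
exists (fun i => (1 - 2 * N * theta)^-1 *: x i) => c.
have -> : \sum_i c i *: ((1 - 2 * N * theta)^-1 *: x i) =
    (1 - 2 * N * theta)^-1 *: \sum_i c i *: x i.
  by rewrite scaler_sumr; apply: eq_bigr => i _; rewrite !scalerA mulrC.
rewrite normrZ gtr0_norm ?invr_gt0// ler_pdivlMl// ler_pdivrMl//.
have /andP[-> hi] := xc c; apply: (le_trans hi); rewrite mulrA.
by rewrite ler_wpM2r ?sumr_ge0//; lra.
Qed.

End FailureGivesEll1.

(** * Random samples and conditional means *)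

Section Sampling.
Variables (R : realType) (T : finType) (n : nat) (p : 'I_n -> R).
Hypotheses (p0 : forall i, 0 <= p i) (p1 : \sum_i p i = 1).
Local Notation sample := {ffun T -> 'I_n}.
Implicit Types (I J : sample) (e : cube T).

Definition weight I : R := \prod_t p (I t).

Definition resample I t i : sample := [ffun s => if s == t then i else I s].

Definition mix e I J : sample := [ffun s => if e s then J s else I s].

Lemma weight_ge0 I : 0 <= weight I.
Proof. by apply: prodr_ge0. Qed.

Lemma sum_weight : \sum_I weight I = 1.
Proof.
by rewrite -(bigA_distr_bigA (fun _ => p)) /= big1.
Qed.

(** Redrawing one entry of an independent sample does not change its law:
    exchanging the new entry with the old one is an involution that preserves
    the weights. *)
Lemma sum_weight_resample (V : lmodType R) (h : sample -> V) t :
  \sum_i \sum_I (p i * weight I) *: h (resample I t i) =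
  \sum_I weight I *: h I.
Proof.
have -> : \sum_I weight I *: h I = \sum_i \sum_I (p i * weight I) *: h I.
  under [RHS]eq_bigr => i _.
    under eq_bigr do rewrite -scalerA.
    rewrite -scaler_sumr; over.
  by rewrite -scaler_suml p1 scale1r.
rewrite !pair_bigA /=.
pose swap (q : 'I_n * sample) := (q.2 t, resample q.2 t q.1).
have swapK : involutive swap.
  move=> [i I]; rewrite /swap /= ffunE eqxx; congr (_, _).
  by apply/ffunP => s; rewrite !ffunE; case: eqVneq => [->|].
rewrite (reindex_inj (inv_inj swapK)) /=; apply: eq_bigr => -[i I] _ /=.
congr (_ *: h _); last exact: (congr1 snd (swapK (i, I))).
rewrite /weight (bigD1 t)//= [in RHS](bigD1 t)//= ffunE eqxx mulrCA.
congr (_ * (_ * _)); apply: eq_bigr => s /negPf st.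
by rewrite ffunE st.
Qed.

(** Exchanging entries between two independent samples does not change their
    joint law. *)
Lemma sum_weight_mix (V : lmodType R) (h : sample -> V) e :
  \sum_I \sum_J (weight I * weight J) *: h (mix e I J) =
  \sum_I weight I *: h I.
Proof.
have -> : \sum_I weight I *: h I = \sum_I \sum_J (weight I * weight J) *: h I.
  apply: eq_bigr => I _; rewrite -scaler_suml -mulr_sumr sum_weight.
  by rewrite mulr1.
rewrite !pair_bigA /=.
pose swap (q : sample * sample) := (mix e q.1 q.2, mix e q.2 q.1).
have swapK : involutive swap.
  by move=> [I J]; congr (_, _); apply/ffunP => s; rewrite !ffunE; case: (e s).
rewrite (reindex_inj (inv_inj swapK)) /=; apply: eq_bigr => -[I J] _ /=.
congr (_ *: h _); last exact: (congr1 fst (swapK (I, J))).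
rewrite /weight -!big_split /=; apply: eq_bigr => s _; rewrite !ffunE.
by case: (e s); rewrite // mulrC.
Qed.

Variables (X : normedModType R) (y : sample -> X).

Definition sample_mean : X := \sum_I weight I *: y I.

Definition cond_mean t i : X := \sum_I weight I *: y (resample I t i).

Definition mixed_coef t I J : X := sign_coef (fun e => y (mix e I J)) t.

(** Symmetrization.  Start from a sample whose entry at t is i and mix it with an
    independent sample J: if e_t keeps the entry, the mean over both samples is
    the conditional mean; if e_t replaces it, the result is an unconditioned
    sample.  So averaging e_t times the mean over the signs gives half the
    difference. *)
Lemma cond_mean_sub t i : cond_mean t i - sample_mean =
  2 *: \sum_I \sum_J (weight I * weight J) *: mixed_coef t (resample I t i) J.
Proof.
pose F e : X := if e t then - sample_mean else cond_mean t i.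
have FE e : F e = (-1) ^+ (e t) *: \sum_I \sum_J (weight I * weight J) *:
    y (mix e (resample I t i) J).
  rewrite /F; case et : (e t); rewrite ?expr1 ?expr0 ?scaleN1r ?scale1r.
    congr (- _); rewrite /sample_mean -(sum_weight_mix y e).
    apply: eq_bigr => I _; apply: eq_bigr => J _; congr (_ *: y _).
    by apply/ffunP => s; rewrite !ffunE; case: eqVneq => // ->; rewrite et.
  rewrite /cond_mean -(sum_weight_mix (fun I => y (resample I t i)) e).
  apply: eq_bigr => I _; apply: eq_bigr => J _; congr (_ *: y _).
  by apply/ffunP => s; rewrite !ffunE; case: eqVneq => // ->; rewrite et.
have -> : \sum_I \sum_J (weight I * weight J) *: mixed_coef t (resample I t i) J
    = mean F.
  rewrite (eq_mean FE); under [RHS]eq_mean do rewrite scaler_sumr.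
  rewrite mean_sum; apply: eq_bigr => I _.
  under [RHS]eq_mean do rewrite scaler_sumr.
  rewrite mean_sum; apply: eq_bigr => J _; rewrite /mixed_coef /sign_coef -meanZ.
  by apply: eq_mean => e; rewrite !scalerA mulrC.
rewrite scaler_nat mulr2n.
rewrite -[in X in _ = _ + X](mean_reindex F (flip_inj (d := [ffun=> true]))) -meanD.
rewrite -[LHS](mean_const (card_cube_gt0 T)); apply: eq_mean => e.
by rewrite /F !ffunE /=; case: (e t) => /=; rewrite // addrC.
Qed.

Lemma sum_norm_cond_mean_sub (B : R) : 0 <= B -> sign_ineq X T B ->
  (forall I, `|y I| <= 1) ->
  \sum_t \sum_i p i * `|cond_mean t i - sample_mean| <=
    2 * (Num.sqrt B * #|T|%:R).
Proof.
move=> B0 QT y1.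
have w2 I J : 0 <= weight I * weight J by rewrite mulr_ge0 ?weight_ge0.
have stepD t : \sum_i p i * `|cond_mean t i - sample_mean| <=
    2 * \sum_I \sum_J weight I * weight J * `|mixed_coef t I J|.
  pose H I : R^o := \sum_J weight J * `|mixed_coef t I J|.
  have -> : \sum_I \sum_J weight I * weight J * `|mixed_coef t I J| =
      \sum_I weight I *: H I.
    apply: eq_bigr => I _; rewrite -[RHS]/(weight I * H I) mulr_sumr.
    by apply: eq_bigr => J _; rewrite mulrA.
  rewrite -(sum_weight_resample H t) mulr_sumr; apply: ler_sum => i _.
  rewrite cond_mean_sub normrZ ger0_norm// mulrCA ler_wpM2l//.
  have -> : \sum_I (p i * weight I) *: H (resample I t i) =
      p i * \sum_I \sum_J (weight I * weight J) * `|mixed_coef t (resample I t i) J|.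
    rewrite mulr_sumr; apply: eq_bigr => I _.
    rewrite -[LHS]/(p i * weight I * H (resample I t i)) -mulrA; congr (_ * _).
    by rewrite mulr_sumr; apply: eq_bigr => J _; rewrite mulrA.
  rewrite ler_wpM2l//; apply: (le_trans (ler_norm_sum _ _ _)).
  apply: ler_sum => I _; apply: (le_trans (ler_norm_sum _ _ _)).
  by apply: ler_sum => J _; rewrite normrZ ger0_norm.
apply: (le_trans (ler_sum _ (fun t _ => stepD t))).
rewrite -mulr_sumr ler_wpM2l// exchange_big /=.
have coefS I J : \sum_t `|mixed_coef t I J| <= Num.sqrt B * #|T|%:R.
  have sq : \sum_t `|mixed_coef t I J| ^+ 2 <= B * #|T|%:R.
    apply: (le_trans (QT _)); rewrite ler_piMr ?mulr_ge0//.
    rewrite -[leRHS](mean_const (card_cube_gt0 T) (1 : R^o)); apply: le_mean => e.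
    by rewrite -(expr1n _ 2) lerXn2r ?nnegrE.
  have [T0|T0] := posnP #|T|.
    rewrite T0 mulr0 big1// => t _; have /card0_eq/(_ t) := T0.
    by rewrite inE.
  have nT : 0 < #|T|%:R :> R by rewrite ltr0n.
  have := mean_sqr_ge T0 (fun t => `|mixed_coef t I J| : R^o).
  move=> /(ler_wpM2l (ltW (exprn_gt0 2 nT))).
  rewrite -exprMn (card_meanR T0 (fun t => `|mixed_coef t I J| : R^o)) => h.
  rewrite -(@ler_pXn2r _ 2%N) ?nnegrE ?sumr_ge0 ?mulr_ge0 ?sqrtr_ge0//.
  apply: (le_trans h); rewrite expr2 -mulrA.
  rewrite (card_meanR T0 (fun t => `|mixed_coef t I J| ^+ 2 : R^o)).
  rewrite exprMn sqr_sqrtr//.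
  by apply: (le_trans (ler_wpM2l (ltW nT) sq)); rewrite expr2 mulrCA.
apply: (@le_trans _ _ (\sum_I weight I * (Num.sqrt B * #|T|%:R))); last first.
  by rewrite -mulr_suml sum_weight mul1r.
apply: ler_sum => I _; rewrite exchange_big /=.
apply: (@le_trans _ _ (\sum_J weight I * weight J * (Num.sqrt B * #|T|%:R))).
  by apply: ler_sum => J _; rewrite -mulr_sumr ler_wpM2l.
by rewrite -mulr_suml -mulr_sumr sum_weight mulr1.
Qed.

End Sampling.

(** * An approximate minimax principle *)

Section ApproxMinimax.
Variables (R : realType) (n : nat).
Implicit Types (u v : 'I_n -> R).

(** Minimize D u, the sum of the squared positive parts of u_i - r.  If its
    infimum d were positive, take u with D u close to d, and let p be
    proportional to the positive parts of u_i - r.  A vector v whose p-average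
    is at most r gives a descent direction: a step of length t towards v
    changes D by at most - 2 t D u + O(t^2). *)
Lemma approx_minimax (U : set ('I_n -> R)) (M r : R) : 0 < M ->
  (exists u, U u) ->
  (forall u i, U u -> 0 <= u i <= M) ->
  (forall u v t, U u -> U v -> 0 <= t <= 1 ->
     exists2 w, U w & forall i, w i <= (1 - t) * u i + t * v i) ->
  (forall p : 'I_n -> R, (forall i, 0 <= p i) -> \sum_i p i = 1 ->
     exists2 u, U u & \sum_i p i * u i <= r) ->
  forall e, 0 < e -> exists2 u, U u & forall i, u i <= r + e.
Proof.
move=> M0 [u0 Uu0] UM Ucvx Uavg e e0.
pose pos (a : R) := Num.max 0 a.
pose D u := \sum_i pos (u i - r) ^+ 2.
have pos_ge0 a : 0 <= pos a by rewrite le_max lexx.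
have pos_ge a : a <= pos a by rewrite le_max lexx orbT.
have posM a : pos a * a = pos a ^+ 2.
  by rewrite /pos; case: (leP 0 a) => _; rewrite ?mul0r ?expr0n// expr2.
have posD a h : pos (a + h) ^+ 2 <= pos a ^+ 2 + 2 * pos a * h + h ^+ 2.
  rewrite /pos; case: (leP 0 a) => a0; case: (leP 0 (a + h)) => ah0; nra.
have D_ge0 u : 0 <= D u by apply: sumr_ge0 => i _; exact: sqr_ge0.
have hinf : has_inf (D @` U).
  by split; [exists (D u0), u0|exists 0; move=> _ [u _ <-]].
pose d := inf (D @` U).
have dD u : U u -> d <= D u by move=> Uu; apply: (inf_lbound hinf.2); exists u.
have [dlt|dge] := ltP d (e ^+ 2).
  have [_ [u Uu <-] Du] := inf_lt hinf.1 dlt.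
  exists u => // i; rewrite -lerBlDl; apply: (le_trans (pos_ge _)).
  rewrite -(@ler_pXn2r _ 2%N) ?nnegrE ?(ltW e0)//.
  apply: (le_trans _ (ltW Du)); rewrite /D (bigD1 i)//= lerDl.
  by apply: sumr_ge0 => j _; exact: sqr_ge0.
exfalso.
have d0 : 0 < d by apply: lt_le_trans dge; rewrite exprn_gt0.
pose A := n%:R * M ^+ 2 + d; have A0 : 0 < A.
  by rewrite ltr_wpDl// mulr_ge0// sqr_ge0.
(* The step length for which the quadratic error is at most t d. *)
pose t := d / A.
have t0 : 0 < t by rewrite divr_gt0.
have t1 : t <= 1 by rewrite ler_pdivrMr// mul1r lerDr mulr_ge0// sqr_ge0.
have tA : n%:R * M ^+ 2 * t <= d.
  by rewrite mulrA ler_pdivrMr// [leRHS]mulrC ler_wpM2r ?(ltW d0)// lerDl (ltW d0).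
clearbody t.
have [_ [u Uu <-] Du] := inf_adherent (divr_gt0 (mulr_gt0 t0 d0) (ltr0Sn R 1)) hinf.
pose s := \sum_i pos (u i - r).
have s0 : 0 < s.
  rewrite lt_neqAle sumr_ge0// andbT; apply/negP => /eqP s_eq0.
  have := lt_le_trans d0 (dD u Uu); rewrite /D big1 ?ltxx// => i _.
  have /psumr_eq0P -> // : \sum_i pos (u i - r) = 0 by [].
  by rewrite expr0n.
have [v Uv vr] : exists2 v, U v & \sum_i (pos (u i - r) / s) * v i <= r.
  apply: Uavg => [i|]; first by rewrite divr_ge0// ltW.
  by rewrite -mulr_suml divff// gt_eqF.
have vr' : \sum_i pos (u i - r) * (v i - u i) <= - D u.
  have -> : \sum_i pos (u i - r) * (v i - u i) =
      s * (\sum_i (pos (u i - r) / s) * v i) - s * r - D u.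
    rewrite /D /s mulr_sumr mulr_suml -!sumrB; apply: eq_bigr => i _.
    rewrite -posM -/s; field; exact: lt0r_neq0.
  by rewrite -mulrBr gerDr mulr_ge0_le0 ?(ltW s0)// subr_le0.
have [w Uw wuv] : exists2 w, U w & forall i, w i <= (1 - t) * u i + t * v i.
  by apply: Ucvx; rewrite // (ltW t0).
have : D w <= D u - 2 * t * D u + t ^+ 2 * (n%:R * M ^+ 2).
  apply: (@le_trans _ _ (\sum_i (pos (u i - r) ^+ 2 +
      2 * t * (pos (u i - r) * (v i - u i)) + t ^+ 2 * M ^+ 2))).
    apply: ler_sum => i _.
    have wi : w i - r <= (u i - r) + t * (v i - u i) by have := wuv i; lra.
    apply: (@le_trans _ _ (pos ((u i - r) + t * (v i - u i)) ^+ 2)).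
      rewrite lerXn2r ?nnegrE// /pos ge_max le_max lexx /= le_max.
      by rewrite wi orbT.
    apply: (le_trans (posD _ _)).
    have : (v i - u i) ^+ 2 <= M ^+ 2.
      by have := UM u i Uu; have := UM v i Uv; nra.
    move=> /(ler_wpM2l (sqr_ge0 t)).
    have -> : 2 * pos (u i - r) * (t * (v i - u i)) =
      2 * t * (pos (u i - r) * (v i - u i)) by ring.
    by move=> h; rewrite lerD2l exprMn.
  rewrite !big_split /= -mulr_sumr sumr_const card_ord -mulr_natr.
  rewrite -/(D u); have := ler_wpM2l (ltW t0) vr'; lra.
have := dD _ Uw; have := ler_wpM2l (ltW t0) (dD _ Uu).
have := ler_wpM2l (ltW t0) tA; have := mulr_gt0 t0 d0; move: Du; rewrite -/d; lra.
Qed.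

End ApproxMinimax.

(** * Helly-type theorems *)

Section ConvexSets.
Variables (R : realType) (V : lmodType R) (K : set V).
Hypothesis K_convex : convex_set K.

Lemma convex_set_comb (x y : V) (t : R) :
  K x -> K y -> 0 <= t <= 1 -> K (t *: x + (1 - t) *: y).
Proof.
move=> Kx Ky /andP[t0 t1]; apply: set_mem.
exact: (@K_convex x y (Itv01 t0 t1) (mem_set Kx) (mem_set Ky)).
Qed.

Lemma convex_set_sum (I : finType) (w : I -> R) (v : I -> V) :
  (forall i, 0 <= w i) -> \sum_i w i = 1 -> (forall i, K (v i)) ->
  K (\sum_i w i *: v i).
Proof.
move=> w0 w1 Kv.
have [i0 _] : exists i0 : I, True.
  apply: contrapT => /forallNP noI; move/eqP: w1.
  by rewrite big1 ?(eq_sym 0) ?oner_eq0// => i; have := noI i.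
(* Missing weight is put on a point x; merging the head of the list into x
   keeps x in K. *)
suff gen (s : seq I) x : K x -> \sum_(i <- s) w i <= 1 ->
    K (\sum_(i <- s) w i *: v i + (1 - \sum_(i <- s) w i) *: x).
  have := gen (index_enum I) _ (Kv i0); rewrite w1 lexx subrr scale0r addr0.
  exact.
elim: s x => [|i s IH] x Kx.
  by rewrite !big_nil add0r subr0 scale1r.
rewrite !big_cons; set W := \sum_(j <- s) w j => W1.
have W0 : W <= 1 by apply: le_trans W1; rewrite lerDr.
have [W_eq1|W_neq1] := eqVneq W 1.
  have wi0 : w i = 0 by apply/eqP; rewrite eq_le w0 andbT; move: W1; lra.
  by rewrite wi0 scale0r !add0r; exact: IH.
have W_lt1 : 0 < 1 - W by rewrite subr_gt0 lt_neqAle W_neq1.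
pose t := w i / (1 - W).
have t01 : 0 <= t <= 1.
  by rewrite divr_ge0 ?(ltW W_lt1)//= ler_pdivrMr// mul1r lerBrDr.
have := IH _ (convex_set_comb (Kv i) Kx t01) W0; rewrite -/W.
rewrite scalerDr !scalerA addrA (addrC (w i *: _)).
have -> : (1 - W) * t = w i by rewrite mulrC divfK// gt_eqF.
by have -> : (1 - W) * (1 - t) = 1 - (w i + W)
  by rewrite /t; field; rewrite gt_eqF.
Qed.

End ConvexSets.

Lemma norm_convex_sum_le (R : realType) (X : normedModType R) (I : finType)
    (w : I -> R) (v : I -> X) (r : R) :
  (forall i, 0 <= w i) -> \sum_i w i = 1 -> (forall i, `|v i| <= r) ->
  `|\sum_i w i *: v i| <= r.
Proof.
move=> w0 w1 vr; apply: (le_trans (ler_norm_sum _ _ _)).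
rewrite -[leRHS]mul1r -w1 mulr_suml; apply: ler_sum => i _.
by rewrite normrZ ger0_norm// ler_wpM2l.
Qed.

Lemma dist_le (R : realType) (X : normedModType R) (K : set X) (x z : X) (r : R) :
  K z -> `|x - z| <= r -> (dist x K <= r%:E)%E.
Proof.
move=> Kz xz; apply: (@le_trans _ _ `|x - z|%:E); last by rewrite lee_fin.
by apply: ereal_inf_lbound; exists z.
Qed.

Lemma exists_superset (T : finType) (A : {set T}) (k : nat) :
  (#|A| <= k <= #|T|)%N -> exists2 J : {set T}, A \subset J & #|J| = k.
Proof.
move=> /andP[Ak]; rewrite -(subnKC Ak); elim: (k - #|A|)%N => [|d IH] dT.
  by exists A => //; rewrite addn0.
have [|J AJ Jd] := IH; first by apply: leq_trans dT; rewrite leq_add2l.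
have [x xJ] : exists x, x \notin J.
  apply/existsP; rewrite -negb_forall; apply/negP => /forallP JT.
  move: dT; rewrite addnS -Jd ltnNge => /negP; apply.
  by rewrite -cardsT; apply/subset_leq_card/fintype.subsetP => x _; exact: JT.
exists (x |: J); first exact: fintype.subset_trans AJ (finset.subsetUr _ _).
by rewrite cardsU1 xJ Jd addnS.
Qed.

Section Helly.
Variables (R : realType) (X : normedModType R).

(** The point x is the mean of y over samples with law p, and z_i averages the
    means conditioned on one entry being i.  In such samples i occurs, so that
    y lies in K_i. *)
Lemma helly_average (T : finType) (B : R) (n : nat) (K : 'I_n -> set X)
    (y : {ffun T -> 'I_n} -> X) (p : 'I_n -> R) :
  0 <= B -> sign_ineq X T B -> (0 < #|T|)%N ->
  (forall i, convex_set (K i)) ->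
  (forall I, `|y I| <= 1) ->
  (forall (I : {ffun T -> 'I_n}) t, K (I t) (y I)) ->
  (forall i, 0 <= p i) -> \sum_i p i = 1 ->
  exists (x : X) (z : 'I_n -> X), [/\ `|x| <= 1, forall i, `|z i| <= 1,
    forall i, K i (z i) & \sum_i p i * `|z i - x| <= 2 * Num.sqrt B].
Proof.
move=> B0 QT T0 Kc y1 yK p0 p1.
have nT : 0 < #|T|%:R :> R by rewrite ltr0n.
have w0 := weight_ge0 (T := T) p0; have w1 := sum_weight T p1.
exists (sample_mean p y), (fun i => mean (fun t => cond_mean p y t i)).
have meanE i : mean (fun t => cond_mean p y t i) =
    \sum_t #|T|%:R^-1 *: cond_mean p y t i by rewrite /mean scaler_sumr.
have T1 : \sum_(t : T) #|T|%:R^-1 = 1 :> R.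
  by rewrite sumr_const -[_ *+ _]mulr_natr mulVf// gt_eqF.
have Ti (t : T) : 0 <= #|T|%:R^-1 :> R by rewrite invr_ge0.
split.
- exact: norm_convex_sum_le.
- move=> i; rewrite meanE; apply: norm_convex_sum_le => // t.
  exact: norm_convex_sum_le.
- move=> i; rewrite meanE; apply: convex_set_sum => // t.
  apply: convex_set_sum => // I.
  by have := yK (resample I t i) t; rewrite ffunE eqxx.
rewrite -(ler_pM2l nT).
have := sum_norm_cond_mean_sub p0 p1 B0 QT y1.
have -> : #|T|%:R * (2 * Num.sqrt B) = 2 * (Num.sqrt B * #|T|%:R) by ring.
apply: le_trans; rewrite exchange_big mulr_sumr /=; apply: ler_sum => i _.
rewrite -mulr_sumr mulrCA ler_wpM2l//.
have -> : mean (fun t => cond_mean p y t i) - sample_mean p y =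
    mean (fun t => cond_mean p y t i - sample_mean p y).
  by rewrite meanD mean_const.
by rewrite -(card_meanR T0) ler_pM2l// norm_mean_le.
Qed.

(** The vectors of distances |z_i - x|, with x and the z_i in the unit ball, form
    a bounded family that is convex up to decreasing its entries; the averaged
    statement then holds for all indices at once. *)
Lemma helly_of_sign_ineq (T : finType) (B : R) (n : nat) (K : 'I_n -> set X) :
  0 <= B -> sign_ineq X T B -> (0 < #|T|)%N -> (0 < n)%N ->
  (forall i, convex_set (K i)) ->
  (forall I : {ffun T -> 'I_n}, exists2 y, `|y| <= 1 & forall t, K (I t) y) ->
  forall e, 0 < e ->
  exists x, forall i, (dist x (K i) <= (2 * Num.sqrt B + e)%:E)%E.
Proof.
move=> B0 QT T0 n0 Kc Ky e e0.
have /choice[y yP] : forall I : {ffun T -> 'I_n}, exists y,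
    `|y| <= 1 /\ forall t, K (I t) y.
  by move=> I; have [y y1 yK] := Ky I; exists y.
pose U := [set u : 'I_n -> R | exists (x : X) (z : 'I_n -> X),
  [/\ `|x| <= 1, forall i, `|z i| <= 1, forall i, K i (z i) &
      forall i, u i = `|z i - x|]].
have avg (p : 'I_n -> R) : (forall i, 0 <= p i) -> \sum_i p i = 1 ->
    exists2 u, U u & \sum_i p i * u i <= 2 * Num.sqrt B.
  move=> p0 p1.
  have [x [z [x1 z1 zK pz]]] := helly_average B0 QT T0 Kc
    (fun I => (yP I).1) (fun I => (yP I).2) p0 p1.
  by exists (fun i => `|z i - x|) => //; exists x, z.
have U0 : exists u, U u.
  have nR : 0 < n%:R :> R by rewrite ltr0n.
  have [||u Uu _] := avg (fun=> n%:R^-1); last by exists u.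
    by move=> i; rewrite invr_ge0.
  by rewrite sumr_const card_ord -[_ *+ _]mulr_natr mulVf// gt_eqF.
have U2 (u : 'I_n -> R) i : U u -> 0 <= u i <= 2.
  move=> [x [z [x1 z1 _ ->]]]; rewrite normr_ge0 /=.
  by apply: (le_trans (ler_normB _ _)); have := z1 i; lra.
have Ucvx (u v : 'I_n -> R) t : U u -> U v -> 0 <= t <= 1 ->
    exists2 w, U w & forall i, w i <= (1 - t) * u i + t * v i.
  move=> [x [z [x1 z1 zK uE]]] [x' [z' [x'1 z'1 z'K vE]]] /andP[t0 t1].
  have s0 : 0 <= 1 - t by rewrite subr_ge0.
  have s01 : 0 <= 1 - t <= 1 by rewrite s0 gerBl.
  have ball1 (a b : X) : `|a| <= 1 -> `|b| <= 1 ->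
      `|(1 - t) *: a + (1 - (1 - t)) *: b| <= 1.
    move=> a1 b1; rewrite subKr; apply: (le_trans (ler_normD _ _)).
    rewrite !normrZ !ger0_norm//.
    by have := ler_wpM2l t0 b1; have := ler_wpM2l s0 a1; lra.
  pose c (a b : X) := (1 - t) *: a + (1 - (1 - t)) *: b.
  exists (fun i => `|c (z i) (z' i) - c x x'|).
    exists (c x x'), (fun i => c (z i) (z' i)); split=> [|i|i|//].
    - exact: ball1.
    - exact: ball1.
    - exact: convex_set_comb.
  move=> i; rewrite uE vE /c subKr opprD addrACA -!scalerBr.
  by apply: (le_trans (ler_normD _ _)); rewrite !normrZ !ger0_norm.
have [u [x [z [_ _ zK uE]]] u_le] :=
  approx_minimax (ltr0Sn R 1) U0 U2 Ucvx avg e0.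
exists x => i; apply: (dist_le (zK i)).
by rewrite distrC -uE.
Qed.

End Helly.

(** With b <= a^(-w) and k < a^(m + 1), where m = trunc_log a k, one has
    b^m <= a^(-w m) <= a^w k^(-w).  The factor a^w pays for the rounding of k
    down to a power of a. *)
Lemma geometric_rate_le_power (R : realType) (a : nat) (b : R) :
  (1 < a)%N -> 0 < b < 1 -> exists2 w, 0 < w <= 1 / 2 &
    forall k, (0 < k)%N -> b ^+ trunc_log a k <= a%:R `^ w * k%:R `^ (- w).
Proof.
move=> a1 /andP[b0 b1].
have aR : 1 < a%:R :> R by rewrite ltr1n.
have a0 : 0 < a%:R :> R by exact: lt_trans aR.
have lna : 0 < ln a%:R :> R by rewrite ln_gt0.
have lnb : ln b < 0 by rewrite ln_lt0// b0.
pose w := Num.min (1 / 2) (- ln b / ln a%:R); exists w.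
  by rewrite lt_min ge_min lexx /= andbT !divr_gt0// oppr_gt0.
have wb : w * ln a%:R <= - ln b.
  by rewrite -ler_pdivlMr// ge_min lexx orbT.
have w0 : 0 < w by rewrite lt_min !divr_gt0// oppr_gt0.
set c := a%:R `^ w; have c0 : 0 < c by rewrite powR_gt0.
have bc : b <= c^-1.
  rewrite -powRN /powR gt_eqF// -[leLHS]lnK ?posrE// ler_expR mulNr; lra.
move=> k k0; have /andP[_ ka] := trunc_log_bounds a1 k0.
have kR : 0 < k%:R :> R by rewrite ltr0n.
have kc : k%:R `^ w <= c ^+ (trunc_log a k).+1.
  rewrite /c -powR_mulrn ?powR_ge0// -powRrM mulrC powRrM powR_mulrn ?(ltW a0)//.
  apply: ge0_ler_powR; rewrite ?nnegrE ?(ltW w0) ?(ltW kR) ?exprn_ge0 ?(ltW a0)//.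
  by rewrite -natrX ler_nat ltnW.
apply: (@le_trans _ _ (c^-1 ^+ trunc_log a k)).
  by rewrite lerXn2r ?nnegrE ?invr_ge0 ?(ltW b0) ?(ltW c0).
rewrite powRN -ler_pdivrMl// -exprS exprVn.
by rewrite lef_pV2 ?posrE ?exprn_gt0 ?powR_gt0.
Qed.

Theorem theorem1p2 (R : realType) (X : completeNormedModType R)
    (hX : super_reflexive X) :
  exists Cr w : R, 0 < Cr /\ 0 < w <= 1 / 2 /\
    forall n k : nat, (1 <= k <= n)%N ->
    forall K : 'I_n -> set X,
      (forall i, convex_set (K i)) ->
      (forall J : {set 'I_n}, #|J| = k ->
         @unit_ball R X `&` \bigcap_(j in [set` J]) K j !=set0) ->
      exists x : X, forall i : 'I_n,
        (dist x (K i) <= (Cr * k%:R `^ (- w))%:E)%E.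
Proof.
have [T [B [T1 /andP[B0 B1] QT]]] :=
  sign_ineq_or_ell1n (super_reflexive_not_ell1n hX).
have sB : 0 < Num.sqrt B < 1.
  by rewrite sqrtr_gt0 B0 -[ltRHS]sqrtr1 ltr_sqrt.
have [w w12 rate] := geometric_rate_le_power T1 sB.
have TR : 0 < #|T|%:R :> R by rewrite ltr0n ltnW.
exists (4 * #|T|%:R `^ w), w; split; first by rewrite mulr_gt0// powR_gt0.
split=> // n k /andP[k0 kn] K Kc KJ.
(* Only samples of size |S| = |T|^m <= k are used; their entries are contained
   in a set of exactly k indices. *)
have [S [cS QS]] := sign_ineq_exp (trunc_log #|T| k) (ltW B0) QT.
have /andP[Sk _] := trunc_log_bounds T1 k0.
have kR : 0 < k%:R :> R by rewrite ltr0n.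
pose e := 2 * (#|T|%:R `^ w * k%:R `^ (- w)).
have e0 : 0 < e by rewrite !mulr_gt0// powR_gt0.
have S0 : (0 < #|S|)%N by rewrite cS expn_gt0 ltnW.
have KI (I : {ffun S -> 'I_n}) : exists2 y, `|y| <= 1 & forall t, K (I t) y.
  have [|J IJ Jk] := @exists_superset _ (I @: S) k.
    by rewrite card_ord kn andbT (leq_trans (leq_imset_card _ _))// cS.
  have [y [y1 yK]] := KJ J Jk; exists y => // t; apply: yK => /=.
  by apply: (fintype.subsetP IJ); exact: imset_f.
have [x xP] := helly_of_sign_ineq (exprn_ge0 _ (ltW B0)) QS S0
  (leq_trans k0 kn) Kc KI e0.
exists x => i; apply: (le_trans (xP i)); rewrite lee_fin.
have -> : 4 * #|T|%:R `^ w * k%:R `^ (- w) = e + e by rewrite /e; ring.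
have -> m : Num.sqrt (B ^+ m) = Num.sqrt B ^+ m.
  by elim: m => [|m IH]; rewrite ?sqrtr1// !exprS sqrtrM ?(ltW B0)// IH.
by rewrite lerD2r ler_pM2l// rate.
Qed.
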